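(* If $\phi=\{\phi_t\}_{t\in\mathbb{R}}$ is a continuous flow on a compact metric space $(X,d)$, then the strong chain recurrent set is given by $$\mathcal{SCR}(\phi)=\bigcap\{B\cup B^{\bullet}:\ B \text{ is strongly stable}\}.$$
   Context: Notation: $\phi_I(S)=\{\phi_t(x): t\in I, x\in S\}$ for $I\subseteq\mathbb{R}$, $S\subseteq X$; $cl$ denotes closure; $d(x,S)=\inf_{s\in S}d(x,s)$ (with $\inf\emptyset=+\infty$). The $\omega$-limit of $S\subseteq X$ is $\omega(S)=\bigcap_{T\ge 0}cl(\phi_{[T,+\infty)}(S))$, and $\omega(x)=\omega(\{x\})$. Strong chains: given $x,y\in X$, $\varepsilon>0$, $T>0$, a strong $(\varepsilon,T)$-chain from $x$ to $y$ is a finite sequence $(x_i,t_i)_{i=1,\dots,n}\subset X\times\mathbb{R}$ ($n\ge 1$) such that $t_i\ge T$ for all $i$, $x_1=x$ and, setting $x_{n+1}:=y$, $\sum_{i=1}^n d(\phi_{t_i}(x_i),x_{i+1})<\varepsilon$. A point $x\in X$ is strong chain recurrent if for all $\varepsilon>0$ and $T>0$ there exists a strong $(\varepsilon,T)$-chain from $x$ to $x$; $\mathcal{SCR}(\phi)$ is the set of strong chain recurrent points. Strongly stable set: a closed set $B\subset X$ is strongly stable if there exist $\rho>0$, a family $(U_\eta)_{\eta\in(0,\rho)}$ of closed nested neighborhoods of $B$ (nested: $U_\eta\subseteq U_\lambda$ for $\eta<\lambda$) and a function $(0,\rho)\ni\eta\mapsto t(\eta)\in(0,+\infty)$ bounded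 on compact subsets of $(0,\rho)$, such that (i) for any $0<\eta<\lambda<\rho$, $\{x\in X: d(x,U_\eta)<\lambda-\eta\}\subseteq U_\lambda$; (ii) $B=\bigcap_{\eta\in(0,\rho)}\omega(U_\eta)$; (iii) for any $0<\eta<\rho$, $cl(\phi_{[t(\eta),+\infty)}(U_\eta))\subseteq U_\eta$. The complementary of a strongly stable set $B$ is $B^{\bullet}=\{x\in X:\ \omega(x)\cap B=\emptyset\}$. *)

(* Defs.v *)
From HB Require Import structures.
From mathcomp Require Import all_boot all_order all_algebra.
From mathcomp Require Import all_classical all_reals all_analysis.

Set Implicit Arguments.
Unset Strict Implicit.
Unset Printing Implicit Defensive.

Import Order.TTheory GRing.Theory Num.Theory.
Import numFieldNormedType.Exports.

Local Open Scope classical_set_scope.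
Local Open Scope ring_scope.

(* Continuity is joint, on R * X with the product topology. *)
Record continuous_flow (R : realType) (X : metricType R) (phi : R -> X -> X)
    : Prop := ContinuousFlow {
  flow_id : forall x, phi 0 x = x;
  flow_add : forall s t x, phi (s + t) x = phi s (phi t x);
  flow_continuous : continuous (fun p : R * X => phi p.1 p.2) }.

Definition flow_image (R : realType) (X : metricType R) (phi : R -> X -> X)
    (I : set R) (S : set X) : set X :=
  [set phi t x | t in I & x in S].

(* The value is +oo when S is empty. *)
Definition dist_set (R : realType) (X : metricType R) (x : X) (S : set X)
    : \bar R :=
  ereal_inf [set (mdist x s)%:E | s in S].

Definition omega_limit (R : realType) (X : metricType R) (phi : R -> X -> X)
    (S : set X) : set X :=
  \bigcap_(T in [set T : R | 0 <= T]) closure (flow_image phi `[T, +oo[ S).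

(* A chain with n.+1 steps: its points are u 0, ..., u n, its times are
   tau 0, ..., tau n, and u n.+1 is the endpoint y. The values of u and tau at
   larger indices play no role. *)
Definition strong_chain (R : realType) (X : metricType R) (phi : R -> X -> X)
    (eps T : R) (x y : X) : Prop :=
  exists (n : nat) (u : nat -> X) (tau : nat -> R),
    [/\ forall i, (i < n.+1)%N -> T <= tau i,
        u 0%N = x,
        u n.+1 = y &
        \sum_(i < n.+1) mdist (phi (tau i) (u i)) (u i.+1) < eps].

Definition strong_chain_recurrent (R : realType) (X : metricType R)
    (phi : R -> X -> X) : set X :=
  [set x | forall eps T : R, 0 < eps -> 0 < T -> strong_chain phi eps T x x].

(* The families U and t are total functions of eta, of which only the values
   on ]0, rho[ are constrained. *)
Definition strongly_stable (R : realType) (X : metricType R)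
    (phi : R -> X -> X) : set (set X) :=
  [set B | closed B /\
    exists (rho : R) (U : R -> set X) (t : R -> R),
      [/\ 0 < rho,
          forall eta, eta \in `]0, rho[ ->
            closed (U eta) /\ B `<=` interior (U eta),
          forall eta lambda, eta \in `]0, rho[ -> lambda \in `]0, rho[ ->
            eta < lambda -> U eta `<=` U lambda &
          forall eta, eta \in `]0, rho[ -> 0 < t eta] /\
      [/\ forall K : set R, compact K -> K `<=` `]0, rho[ ->
            [bounded t eta | eta in K],
          forall eta lambda, 0 < eta -> eta < lambda -> lambda < rho ->
            [set x | (dist_set x (U eta) < (lambda - eta)%:E)%E]
              `<=` U lambda,
          B = \bigcap_(eta in `]0, rho[) omega_limit phi (U eta) &
          forall eta, eta \in `]0, rho[ ->
            closure (flow_image phi `[t eta, +oo[ (U eta)) `<=` U eta]].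

Definition complementary (R : realType) (X : metricType R)
    (phi : R -> X -> X) (B : set X) : set X :=
  [set x | omega_limit phi [set x] `&` B = set0].

(* Main.v *)
Require Import Defs.
From HB Require Import structures.
From mathcomp Require Import all_boot all_order all_algebra.
From mathcomp Require Import all_classical all_reals all_analysis.
From mathcomp Require Import lra.
Import Order.TTheory GRing.Theory Num.Theory.
Import numFieldNormedType.Exports.
Local Open Scope classical_set_scope.
Local Open Scope ring_scope.

(** The size of a chain measures how far it can climb in a family [U eta] of
    nested neighbourhoods: flow steps are free, and a jump of length [d] raises
    the parameter [eta] by about [d].

    Let [x] be strong chain recurrent and [B] strongly stable, with [U] as in
    the definition.  If the omega-limit of [x] meets [B], then the orbit of [x]
    enters [U eta'] for every [eta'], however small.  A chain from [x] to [x]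
    whose times are long enough is in [U eta'] after its first flow step, and
    if its total size is below [eta - eta'], then from there on it stays in [U eta]
    ([chain_stays_in_neighborhood]).  Its last flow step can be taken as long
    as desired, and ends close to [x]: so [x] is in the omega-limit of
    [U eta].  As [eta] is arbitrary, [x] is in [B].

    Conversely, suppose that no chain of size less than [eps] with times at
    least [T] joins [x] to itself.  The cost of reaching a point from [x] by
    chains with times at least [T] is 1-Lipschitz and does not increase along
    the flow after time [T]; therefore its sublevels satisfy the axioms of
    strong stability ([strongly_stable_chain_sublevel]).  The strongly stable
    set that they define consists of points of cost 0, so it misses [x].
    However it contains the omega-limit of [x], because [phi T x] has cost 0,
    and this omega-limit is nonempty by compactness.  So [x] is not in the
    complementary set either. *)

(** * Omega-limits *)

Lemma omega_limit_point_nonempty {R : realType} {X : metricType R}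
    (phi : R -> X -> X) (x : X) :
  compact [set: X] -> omega_limit phi [set x] !=set0.
Proof.
move=> /(_ (phi^~ x @ +oo) _ filterT) [p [_ xp]].
exists p => T /= _ A Ap; apply: xp => //.
apply: filterS (nbhs_pinfty_ge (num_real T)) => t Tt.
by exists t; [rewrite /= in_itv /= andbT|exists x].
Qed.

Lemma omega_limit_point_sub {R : realType} {X : metricType R}
    {phi : R -> X -> X} (s : R) (x : X) (S : set X) :
  continuous_flow phi -> 0 <= s -> S (phi s x) ->
  omega_limit phi [set x] `<=` omega_limit phi S.
Proof.
move=> hphi s0 Sx p xp T /= T0.
apply: closureS (xp (T + s) (addr_ge0 T0 s0)).
move=> _ [t /= + [y -> <-]]; rewrite in_itv /= andbT => Tst.
exists (t - s); first by rewrite /= in_itv /= andbT lerBrDr.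
by exists (phi s x) => //; rewrite -(flow_add hphi) subrK.
Qed.

Lemma omega_limit_enters {R : realType} {X : metricType R}
    {phi : R -> X -> X} (x p : X) (U : set X) :
  omega_limit phi [set x] p -> interior U p -> exists2 s, 0 <= s & U (phi s x).
Proof.
move=> xp Up; have [_ [[s /= + [y -> <-]]]] := xp 0 (lexx 0) U Up.
by rewrite in_itv /= andbT; exists s.
Qed.

(** * Recurrent points and strongly stable sets *)

(** Jumps add up along the chain.  Quantifying over every [lambda] strictly
    above the accumulated length leaves room for the strict inequality in the
    hypothesis on the distance to [U eta].  The conclusion covers all flow
    times [r] from [T] on, and not only [tau i], so that the end of the last
    flow step can be set aside.  The points [u i] themselves are not claimed to
    be in [U lambda], since this may fail for [u 0]. *)
Lemma chain_stays_in_neighborhood {R : realType} {X : metricType R}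
    {phi : R -> X -> X} (U : R -> set X) (eta0 eta1 T : R)
    (n : nat) (u : nat -> X) (tau : nat -> R) :
  (forall eta lambda, eta0 < eta -> eta < lambda -> lambda <= eta1 ->
    [set x | (dist_set x (U eta) < (lambda - eta)%:E)%E] `<=` U lambda) ->
  (forall eta r y, eta0 < eta -> eta <= eta1 -> T <= r ->
    U eta y -> U eta (phi r y)) ->
  (forall i, (i < n)%N -> T <= tau i) ->
  (forall eta r, eta0 < eta -> eta <= eta1 -> T <= r ->
    U eta (phi r (u 0%N))) ->
  forall i, (i <= n)%N -> forall lambda r,
    eta0 + \sum_(j < i) mdist (phi (tau j) (u j)) (u j.+1) < lambda ->
    lambda <= eta1 -> T <= r -> U lambda (phi r (u i)).
Proof.
move=> Ugrow Uflow Ttau U0; elim=> [|i IH] ltin lambda r.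
  by rewrite big_ord0 addr0; exact: U0.
rewrite big_ord_recr /=.
set S := \sum_(j < i) _; set d := mdist _ _ => Slambda lambda1 Tr.
have S0 : 0 <= S by apply: sumr_ge0 => j _; exact: mdist_ge0.
have d0 : 0 <= d by exact: mdist_ge0.
(* [mu] lies strictly between the length so far and [lambda - d] *)
pose mu := (eta0 + S + (lambda - d)) / 2.
have Umu : U mu (phi (tau i) (u i)).
  apply: (IH (ltnW ltin)); last exact: Ttau.
    by rewrite -/S /mu; lra.
  by rewrite /mu; lra.
apply: Uflow => //; first lra.
apply: (Ugrow mu) => //=; [by rewrite /mu; lra|by rewrite /mu; lra|].
apply: (@le_lt_trans _ _ d%:E); last by rewrite lte_fin /mu; lra.
apply: ereal_inf_lbound; exists (phi (tau i) (u i)) => //.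
by rewrite metric_sym.
Qed.

Lemma strong_chain_recurrent_sub_stable {R : realType} {X : metricType R}
    {phi : R -> X -> X} (B : set X) :
  continuous_flow phi -> strongly_stable phi B ->
  strong_chain_recurrent phi `<=` B `|` complementary phi B.
Proof.
move=> hphi [_ [rho [U [t [[rho0 Unbhs Umono tpos] [tbnd Ugrow BE Uflow]]]]]].
move=> x xrec.
have [|] := pselect (omega_limit phi [set x] `&` B = set0); first by right.
move=> /eqP/set0P[p [xp Bp]]; left; rewrite BE => eta.
rewrite /= in_itv /= => /andP[eta0 etarho].
pose eta' := eta / 2.
have eta'0 : 0 < eta' by rewrite /eta'; lra.
have eta'eta : eta' < eta by rewrite /eta'; lra.
have in_rho mu : eta' <= mu -> mu <= eta -> mu \in `]0, rho[.
  by move=> mu1 mu2; rewrite in_itv /=; apply/andP; split; lra.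
have eta'_in : eta' \in `]0, rho[ by apply: in_rho => //; exact: ltW.
have [s s0 Us] := omega_limit_enters _ _ _ xp ((Unbhs eta' eta'_in).2 p Bp).
(* one time after which all neighbourhoods between [eta'] and [eta] are
   forward invariant: the chain has an uncontrolled number of steps, each in a
   neighbourhood of its own *)
have [M [_ tM]] : [bounded t mu | mu in `[eta', eta]%classic].
  apply: tbnd; first exact: segment_compact.
  by move=> mu /=; rewrite in_itv /= => /andP[? ?]; exact: in_rho.
have {}tM mu : eta' <= mu -> mu <= eta -> t mu <= M + 1.
  move=> mu1 mu2; apply: le_trans (ler_norm _) _.
  by apply: (tM (M + 1)); [lra|rewrite /= in_itv /= mu1].
have M0 : 0 < M + 1.
  by apply: lt_le_trans (tpos eta' eta'_in) _; apply: tM => //; exact: ltW.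
have flowU mu r y : eta' <= mu -> mu <= eta -> M + 1 <= r ->
    U mu y -> U mu (phi r y).
  move=> mu1 mu2 Mr Uy; apply: (Uflow mu (in_rho _ mu1 mu2)).
  apply: subset_closure; exists r; last by exists y.
  by rewrite /= in_itv /= andbT (le_trans _ Mr)// tM.
move=> T /= T0 A /nbhs_ballP[e /= e0 eA].
(* [M + 1] lets the flow return to the neighbourhoods, [s] covers the entrance
   time of the first step, and [T] is kept for the end of the last step *)
have [||n [u [tau [Ttau u0 un]]]] :=
  xrec (Num.min e (eta - eta')) (M + 1 + s + T).
- by rewrite lt_min e0 /=; lra.
- lra.
rewrite big_ord_recr lt_min /= un.
set S := \sum_(j < n) _; set d := mdist _ _ => /andP[Se Seta].
have S0 : 0 <= S by apply: sumr_ge0 => j _; exact: mdist_ge0.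
have d0 : 0 <= d by exact: mdist_ge0.
have Uend : U eta (phi (tau n - T) (u n)).
  apply: (chain_stays_in_neighborhood U eta' eta (M + 1 + s) n u tau).
  - by move=> *; apply: Ugrow => //; lra.
  - by move=> mu r y *; apply: flowU => //; lra.
  - by move=> i /ltnW/Ttau; lra.
  - move=> mu r mu1 mu2 Mr; apply: (Umono eta' mu) => //.
      by apply: in_rho => //; exact: ltW.
    rewrite u0 -(subrK s r) (flow_add hphi).
    by apply: flowU => //; lra.
  - by [].
  - by rewrite -/S; lra.
  - exact: lexx.
  - by have := Ttau n (ltnSn n); lra.
exists (phi (tau n) (u n)); split.
  exists T; first by rewrite /= in_itv /= lexx.
  exists (phi (tau n - T) (u n)) => //.
  by rewrite -(flow_add hphi) addrC subrK.
by apply: eA; rewrite ballEmdist /= metric_sym -/d; lra.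
Qed.

(** * The strongly stable set of a point that is not recurrent *)

Lemma strong_chain_flow {R : realType} {X : metricType R}
    {phi : R -> X -> X} (eps T t : R) (x : X) :
  0 < eps -> T <= t -> strong_chain phi eps T x (phi t x).
Proof.
move=> eps0 Tt; exists 0%N, (fun i => if i is 0%N then x else phi t x), (cst t).
by split => //; rewrite big_ord1 /= mdistxx.
Qed.

Lemma strong_chain_target {R : realType} {X : metricType R}
    {phi : R -> X -> X} (eps eps' T : R) (x y z : X) :
  eps + mdist y z <= eps' ->
  strong_chain phi eps T x y -> strong_chain phi eps' T x z.
Proof.
move=> eps_le [n [u [tau [Ttau u0 un usum]]]].
exists n, (fun i => if (i <= n)%N then u i else z), tau.
split => //; first by rewrite ltnn.
move: usum; rewrite !big_ord_recr /= ltnn leqnn un.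
under [X in _ -> X + _ < _]eq_bigr => i _.
  rewrite ltn_ord (ltnW (ltn_ord i)); over.
have := metric_triangle (phi (tau n) (u n)) y z; lra.
Qed.

Lemma strong_chain_rcons_flow {R : realType} {X : metricType R}
    {phi : R -> X -> X} (eps T t : R) (x y : X) :
  T <= t -> strong_chain phi eps T x y -> strong_chain phi eps T x (phi t y).
Proof.
move=> Tt [n [u [tau [Ttau u0 un usum]]]].
exists n.+1, (fun i => if (i <= n.+1)%N then u i else phi t y),
  (fun i => if (i <= n)%N then tau i else t).
split => //; first by move=> i _; case: ifP => // ?; exact: Ttau.
  by rewrite ltnn.
rewrite big_ord_recr /= ltnn leqnn ltnn un mdistxx addr0.
under eq_bigr => i _.
  rewrite ltn_ord leq_ord (ltnW (ltn_ord i)); over.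
exact: usum.
Qed.

(** The points of cost at most [eta], where the cost is the infimum of the
    sizes of the chains from [x] with times at least [T].  The condition is
    imposed for all [eps] above [eta], and not for [eta] itself, in order to
    obtain a closed set. *)
Definition chain_sublevel {R : realType} {X : metricType R}
    (phi : R -> X -> X) (T : R) (x : X) (eta : R) : set X :=
  [set y | forall eps, eta < eps -> strong_chain phi eps T x y].

(** The cost is 1-Lipschitz, since the last jump of a chain can be redirected
    to another endpoint. *)
Lemma chain_sublevel_grow {R : realType} {X : metricType R}
    {phi : R -> X -> X} (T : R) (x y z : X) (eta lambda : R) :
  eta + mdist y z <= lambda ->
  chain_sublevel phi T x eta y -> chain_sublevel phi T x lambda z.
Proof.
move=> yz xy eps lambda_eps.
by apply: (strong_chain_target (eps - mdist y z) _ _ _ y); [lra|apply: xy; lra].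
Qed.

Lemma chain_sublevel_mono {R : realType} {X : metricType R}
    {phi : R -> X -> X} (T : R) (x : X) (eta lambda : R) :
  eta <= lambda ->
  chain_sublevel phi T x eta `<=` chain_sublevel phi T x lambda.
Proof. by move=> le y xy eps lt; apply: xy; exact: le_lt_trans lt. Qed.

Lemma closed_chain_sublevel {R : realType} {X : metricType R}
    {phi : R -> X -> X} (T : R) (x : X) (eta : R) :
  closed (chain_sublevel phi T x eta).
Proof.
move=> y cly eps eta_eps; have e0 : 0 < (eps - eta) / 2 by lra.
have [z [xz]] := cly _ (nbhsx_ballx y _ e0).
rewrite ballEmdist /= metric_sym => zy.
apply: (chain_sublevel_grow _ _ z _ eta ((eta + eps) / 2)); last lra.
  by lra.
exact: xz.
Qed.

Lemma chain_sublevel_interior {R : realType} {X : metricType R}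
    {phi : R -> X -> X} (T : R) (x : X) (eta lambda : R) :
  eta < lambda ->
  chain_sublevel phi T x eta `<=` interior (chain_sublevel phi T x lambda).
Proof.
move=> lt y xy; have e0 : 0 < lambda - eta by lra.
apply/nbhs_ballP; exists (lambda - eta) => // z; rewrite ballEmdist /= => yz.
by apply: (chain_sublevel_grow _ _ y _ eta) => //; lra.
Qed.

(** Extending a chain by a flow step without jump does not change its size. *)
Lemma chain_sublevel_trapping {R : realType} {X : metricType R}
    {phi : R -> X -> X} (T : R) (x : X) (eta : R) :
  closure (flow_image phi `[T, +oo[ (chain_sublevel phi T x eta))
    `<=` chain_sublevel phi T x eta.
Proof.
rewrite [X in _ `<=` X](closure_id _).1; last exact: closed_chain_sublevel.
apply: closureS => _ [t /= + [y xy <-]]; rewrite in_itv /= andbT => Tt eps lt.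
by apply: strong_chain_rcons_flow => //; exact: xy.
Qed.

Lemma omega_limit_chain_sublevel {R : realType} {X : metricType R}
    {phi : R -> X -> X} (T : R) (x : X) (eta : R) : 0 <= T ->
  omega_limit phi (chain_sublevel phi T x eta) `<=` chain_sublevel phi T x eta.
Proof. by move=> T0 y /(_ T T0); exact: chain_sublevel_trapping. Qed.

Lemma strongly_stable_chain_sublevel {R : realType} {X : metricType R}
    {phi : R -> X -> X} (T rho : R) (x : X) : 0 < T -> 0 < rho ->
  strongly_stable phi
    (\bigcap_(eta in `]0, rho[) omega_limit phi (chain_sublevel phi T x eta)).
Proof.
move=> T0 rho0; split.
  apply: closed_bigI => eta _; apply: closed_bigI => s _.
  exact: closed_closure.
exists rho, (chain_sublevel phi T x), (cst T); split; split => //.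
- move=> eta; rewrite in_itv /= => /andP[eta0 etarho].
  split; first exact: closed_chain_sublevel.
  move=> y By; apply: (chain_sublevel_interior _ _ (eta / 2)); first lra.
  apply: omega_limit_chain_sublevel; first exact: ltW.
  by apply: By; rewrite /= in_itv /=; apply/andP; split; lra.
- by move=> eta lambda _ _ lt; apply: chain_sublevel_mono; exact: ltW.
- by move=> K _ _; exists `|T|; split => // M lt y _; exact: ltW.
- move=> eta lambda _ _ _ z /ereal_inf_lt[_ [y xy <-]]; rewrite lte_fin => zy.
  by apply: (chain_sublevel_grow _ _ y _ eta) => //; rewrite metric_sym; lra.
- by move=> eta _; exact: chain_sublevel_trapping.
Qed.

Lemma stable_sub_strong_chain_recurrent {R : realType} {X : metricType R}
    {phi : R -> X -> X} (x : X) :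
  compact [set: X] -> continuous_flow phi ->
  (forall B, strongly_stable phi B -> (B `|` complementary phi B) x) ->
  strong_chain_recurrent phi x.
Proof.
move=> hX hphi xB eps T eps0 T0.
have [xin|] := xB _ (strongly_stable_chain_sublevel T eps x T0 eps0).
  apply: (omega_limit_chain_sublevel T x (eps / 2) (ltW T0)); last lra.
  by apply: xin; rewrite /= in_itv /=; apply/andP; split; lra.
have [p xp] := omega_limit_point_nonempty phi x hX.
rewrite /complementary /= -subset0 => /(_ p); case; split => // eta /=.
rewrite in_itv /= => /andP[eta0 _].
apply: (omega_limit_point_sub T x _ hphi (ltW T0) _ _ xp) => e lt.
by apply: strong_chain_flow => //; exact: lt_trans lt.
Qed.

Theorem theorem2 (R : realType) (X : metricType R) (phi : R -> X -> X)
    (hX : compact [set: X]) (hphi : continuous_flow phi) :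
  strong_chain_recurrent phi
    = \bigcap_(B in strongly_stable phi) (B `|` complementary phi B).
Proof.
apply/seteqP; split => x.
  by move=> xrec B Bstable; exact: strong_chain_recurrent_sub_stable xrec.
exact: stable_sub_strong_chain_recurrent.
Qed.
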